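(* Let $r,s,n$ be positive integers with $s\mid r$, let $\omega\in G(r,s,n)$, and let $m_1,m_2\ge 0$ be integers. Then \[ \widetilde f_{m_1,m_2}^{\omega}=\left(r^{m_1-n+1}\,n^{m_2}\binom{m_1+m_2}{m_1} f_{m_2}^{\phi(\omega)}\right)\widetilde f_{m_1}^{\pi(\omega)}, \] where $\widetilde f_{m_1}^{\pi(\omega)}$ is the connected factorization number of $\pi(\omega)$ in $S_n=G(1,1,n)$, and \[ f_{m_2}^{\phi(\omega)}=\frac{1}{r/s}\Big((r/s-1)^{m_2}-(-1)^{m_2}\Big)+\delta(\omega)(-1)^{m_2}. \]
   Context: Let $r,s,n$ be positive integers with $s\mid r$ and $\zeta_r=e^{2\pi i/r}$. For $1\le i<j\le n$ and $0\le k<r$, let $\sigma_{ij}^{k/r}\in GL(\mathbb{C}^n)$ send $(a_1,\dots,a_n)$ to the vector whose $i$-th coordinate is $\zeta_r^{-k}a_j$, whose $j$-th coordinate is $\zeta_r^{k}a_i$, and whose other coordinates are unchanged. For $1\le i\le n$ and $0<k<r/s$, let $\tau_i^{sk/r}$ multiply the $i$-th coordinate by $\zeta_r^{sk}$ and fix the others. Let $R_1$ be the set of all $\sigma_{ij}^{k/r}$, $R_2$ the set of all $\tau_i^{sk/r}$ (empty if $r=s$), and $R=R_1\sqcup R_2$. The group $G(r,s,n)$ is the group generated by $R$; equivalently, it is the group of $n\times n$ complex matrices with exactly one nonzero entry in each row and column, each nonzero entry an $r$-th root of unity, and the product of the nonzero entries an $(r/s)$-th root of unity. In particular $G(1,1,n)=S_n$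 (permutation matrices), whose set $R$ is the set of transpositions, and $G(r,s,1)=\mu_{r/s}$ (the $(r/s)$-th roots of unity), whose set $R$ is the set of non-identity elements. Let $\pi:G(r,s,n)\to S_n$ replace each nonzero entry by $1$, $\phi:G(r,s,n)\to\mu_{r/s}$ be the product of the nonzero entries, and $\delta(\omega)=1$ if $\phi(\omega)=1$ and $\delta(\omega)=0$ otherwise. For $\omega\in G(r,s,n)$ and $m\ge0$, a factorization of $\omega$ of length $m$ is a tuple $(\rho_1,\dots,\rho_m)\in R^m$ with $\rho_m\cdots\rho_1=\omega$; $f_m^\omega$ is the number of them. Its associated graph has vertex set $\{1,\dots,n\}$ and, for each $t$, an edge $\{i,j\}$ if $\rho_t=\sigma_{ij}^{k/r}$ and a self-loop at $i$ if $\rho_t=\tau_i^{sk/r}$. A factorization is connected if this graph is connected. $\widetilde f_m^\omega$ is the number of connected factorizations of length $m$, and $\widetilde f_{m_1,m_2}^\omega$ is the number of connected factorizations of length $m_1+m_2$ in which exactly $m_1$ factors lie in $R_1$ and $m_2$ lie in $R_2$. For $\kappa\in\mu_{r/s}$, $f_{m}^{\kappa}$ is the number of $m$-tuples of non-identity elements of $\mu_{r/s}$ whose product is $\kappa$. *)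

(* Defs.v *)
From mathcomp Require Import all_boot all_order all_algebra all_field.
Set Implicit Arguments. Unset Strict Implicit. Unset Printing Implicit Defensive.
Import Order.TTheory GRing.Theory Num.Theory.
Local Open Scope ring_scope.

(* zeta_r = e^{2 pi i / r} in algC: r.-root (-1) is the r-th root of -1 with
   minimal non-negative argument, i.e. e^{i pi / r}; its square is e^{2 pi i / r}. *)
Definition zeta (r : nat) : algC := (r.-root (-1)) ^+ 2.

(* Labels of the reflections in R = R1 + R2:
   inl (i, j, k) stands for sigma_{ij}^{k/r} (valid when i < j, k < r),
   inr (i, k)    stands for tau_i^{sk/r}   (valid when 0 < k < r/s). *)
Definition label (r s n : nat) : finType :=
  (('I_n * 'I_n * 'I_r) + ('I_n * 'I_(r %/ s)))%type.

Definition valid_label (r s n : nat) (l : label r s n) : bool :=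
  match l with
  | inl (i, j, _) => (i < j)%N
  | inr (_, k) => (0 < k)%N
  end.

Definition inR1 (r s n : nat) (l : label r s n) : bool :=
  if l is inl _ then true else false.

(* The matrix of the reflection with label l (acting on column vectors). *)
Definition refl_mx (r s n : nat) (l : label r s n) : 'M[algC]_n :=
  match l with
  | inl (i, j, k) =>
      \matrix_(x, y)
        (if x == i then (if y == j then zeta r ^- k else 0)
         else if x == j then (if y == i then zeta r ^+ k else 0)
         else (x == y)%:R)
  | inr (i, k) =>
      \matrix_(x, y)
        (if x == y then (if x == i then zeta r ^+ (s * k) else 1) else 0)
  end.

Definition prod_refl (r s n : nat) (t : seq (label r s n)) : 'M[algC]_n :=
  foldl (fun acc l => refl_mx l *m acc) 1%:M t.

Definition label_edge (r s n : nat) (l : label r s n) (x y : 'I_n) : bool :=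
  match l with
  | inl (i, j, _) => ((x == i) && (y == j)) || ((x == j) && (y == i))
  | inr (i, _) => (x == i) && (y == i)
  end.

Definition fact_graph (r s n : nat) (t : seq (label r s n)) : rel 'I_n :=
  fun x y => has (fun l => label_edge l x y) t.

Definition connected_fact (r s n : nat) (t : seq (label r s n)) : bool :=
  [forall x, forall y, connect (fact_graph t) x y].

Definition is_fact (r s n : nat) (w : 'M[algC]_n) (t : seq (label r s n)) : bool :=
  all (@valid_label r s n) t && (prod_refl t == w).

Definition conn_fact_num (r s n m : nat) (w : 'M[algC]_n) : nat :=
  #|[set t : m.-tuple (label r s n) | is_fact w t && connected_fact t]|.

Definition conn_fact_num2 (r s n m1 m2 : nat) (w : 'M[algC]_n) : nat :=
  #|[set t : (m1 + m2).-tuple (label r s n) |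
       [&& is_fact w t, connected_fact t & count (@inR1 r s n) t == m1]]|.

Definition phi (n : nat) (A : 'M[algC]_n) : algC :=
  \prod_(ij : 'I_n * 'I_n | A ij.1 ij.2 != 0) A ij.1 ij.2.

Definition inG (r s n : nat) (A : 'M[algC]_n) : bool :=
  [&& [forall i, #|[pred j | A i j != 0]| == 1%N],
      [forall j, #|[pred i | A i j != 0]| == 1%N],
      [forall i, forall j, (A i j != 0) ==> (A i j ^+ r == 1)]
    & phi A ^+ (r %/ s) == 1].

Definition pi_mx (n : nat) (A : 'M[algC]_n) : 'M[algC]_n :=
  \matrix_(i, j) (A i j != 0)%:R.

Definition delta (n : nat) (A : 'M[algC]_n) : nat := (phi A == 1).

(* f_m^kappa : m-tuples of non-identity elements of mu_{r/s} with product kappa;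
   mu_{r/s} = { zeta_r^(s k) : k < r/s }, indexed by k. *)
Definition mu_fact_num (r s m : nat) (kappa : algC) : nat :=
  #|[set t : m.-tuple 'I_(r %/ s) |
       all (fun k : 'I_(r %/ s) => k != 0%N :> nat) t
       && (\prod_(k <- t) zeta r ^+ (s * k) == kappa)]|.

(* Main.v *)
Require Import Defs.
From mathcomp Require Import all_boot all_order all_algebra all_fingroup all_field ring.
Import Order.TTheory GRing.Theory Num.Theory.
Set Implicit Arguments. Unset Strict Implicit. Unset Printing Implicit Defensive.

(** Write a monomial matrix as a permutation p together with a vector of exponents
   a in (Z/r)^n. A connected factorization with m1 factors in R1 is an interleaving of
   a word of m1 labelled transpositions with a word of m2 loops. The underlying
   transpositions must form a connected factorization of pi(w) and the loop exponents a
   factorization of phi(w), while the positions of the loops are free (n^m2). It remains to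
   count the labels in (Z/r)^m1 of the transpositions that yield the right exponents. As a
   function of the target, this number is invariant under adding k (e_u - e_v) for each
   edge (u, v) of the graph, pulled back by the partial products; by connectedness it is
   constant on the r^(n-1) vectors with the prescribed coordinate sum, and vanishes elsewhere.
   So it is r^m1 / r^(n-1). The right-hand side is the case r = s = 1, m2 = 0 of the same count.
   For the closed form, once the first of m+1 factors may be the identity, it is determined
   by the other m, which are free; hence f_(m+1) + f_m = (r/s - 1)^m. *)

(** * Sums over words *)

Definition wsum (T : finType) m (F : seq T -> nat) : nat := \sum_(t : m.-tuple T) F t.

Lemma wsum0 (T : finType) (F : seq T -> nat) : wsum 0 F = F [::].
Proof.
rewrite /wsum (big_pred1 [tuple]) // => t.
by apply/esym/eqP; exact: tuple0.
Qed.

Lemma wsumS (T : finType) m (F : seq T -> nat) :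
  wsum m.+1 F = \sum_x wsum m (fun t => F (x :: t)).
Proof.
rewrite /wsum pair_bigA /=.
rewrite (reindex (fun p : T * m.-tuple T => cons_tuple p.1 p.2)) //=.
exists (fun t => (thead t, behead_tuple t)) => [[x t] _|t _] /=.
  by congr pair; apply: val_inj.
by apply: val_inj; rewrite [in RHS](tuple_eta t).
Qed.

Lemma eq_wsum (T : finType) m (F G : seq T -> nat) :
  (forall t, size t = m -> F t = G t) -> wsum m F = wsum m G.
Proof. by move=> eqFG; apply: eq_bigr => t _; rewrite eqFG ?size_tuple. Qed.

Lemma wsum_sum (T I : finType) m (F : I -> seq T -> nat) :
  wsum m (fun t => \sum_i F i t) = \sum_i wsum m (F i).
Proof. exact: exchange_big. Qed.

Lemma wsumMl (T : finType) m c (F : seq T -> nat) :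
  wsum m (fun t => c * F t) = c * wsum m F.
Proof. by rewrite /wsum big_distrr. Qed.

Lemma wsum_exchange (T U : finType) m1 m2 (F : seq T -> seq U -> nat) :
  wsum m1 (fun t => wsum m2 (F t)) = wsum m2 (fun u => wsum m1 (F^~ u)).
Proof. exact: exchange_big. Qed.

Lemma wsum_const (T : finType) m c : @wsum T m (fun=> c) = #|T| ^ m * c.
Proof. by rewrite /wsum sum_nat_const card_tuple. Qed.

Lemma wsum_eq0 (T : finType) m (F : seq T -> nat) :
  (forall t, size t = m -> F t = 0) -> wsum m F = 0.
Proof. by move=> F0; apply: big1 => t _; rewrite F0 ?size_tuple. Qed.

Lemma wsum_zip (A B : finType) m (F : seq (A * B) -> nat) :
  wsum m F = wsum m (fun u => wsum m (fun v => F (zip u v))).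
Proof.
elim: m F => [|m IHm] F; first by rewrite !wsum0.
rewrite !wsumS.
have -> : \sum_p wsum m (fun t => F (p :: t)) =
    \sum_x \sum_y wsum m (fun t => F ((x, y) :: t)).
  by rewrite [RHS]pair_bigA; apply: eq_bigr => -[x y] _.
apply: eq_bigr => x _; under [RHS]eq_wsum => u _ do rewrite wsumS.
by rewrite wsum_sum; apply: eq_bigr => y _; rewrite IHm.
Qed.

(** * Interleavings of two words *)

Section Interleave.

Variables A B : finType.
Implicit Types (a : seq A) (b : seq B) (mk : bitseq).

Definition is_inl (x : A + B) := if x is inl _ then true else false.

(** The branch [[::]] is also the default for a mask that does not fit the two words, which
    [shuffle] excludes. *)
Fixpoint interleave mk a b : seq (A + B) :=
  match mk, a, b with
  | true :: mk', x :: a', _ => inl x :: interleave mk' a' b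
  | false :: mk', _, y :: b' => inr y :: interleave mk' a b'
  | _, _, _ => [::]
  end.

Definition shuffle mk a b := (count id mk == size a) && (size mk == size a + size b).

Lemma shuffle_ind (P : bitseq -> seq A -> seq B -> Prop) :
    P [::] [::] [::] ->
    (forall mk x a b, shuffle mk a b -> P mk a b -> P (true :: mk) (x :: a) b) ->
    (forall mk a y b, shuffle mk a b -> P mk a b -> P (false :: mk) a (y :: b)) ->
  forall mk a b, shuffle mk a b -> P mk a b.
Proof.
move=> P0 Pl Pr; elim=> [|[] mk IHmk] a b.
- by case: a => [|x a]; case: b.
- case: a => [|x a] //= sh; have {}sh : shuffle mk a b by [].
  by apply: Pl => //; apply: IHmk.
case: b => [|y b] /andP[/=]; rewrite add0n => cmk smk.
  by have := count_size id mk; rewrite (eqP cmk) -ltnS (eqP smk) addn0 ltnn.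
have sh : shuffle mk a b by rewrite /shuffle cmk -eqSS (eqP smk) addnS /=.
by apply: Pr => //; apply: IHmk.
Qed.

Lemma all_interleave (P : pred (A + B)) mk a b : shuffle mk a b ->
  all P (interleave mk a b) = all (P \o inl) a && all (P \o inr) b.
Proof.
move: mk a b; apply: shuffle_ind => [|mk x a b _|mk a y b _] //= ->.
  by rewrite andbA.
by rewrite andbCA.
Qed.

Lemma has_interleave (P : pred (A + B)) mk a b : shuffle mk a b ->
  has P (interleave mk a b) = has (P \o inl) a || has (P \o inr) b.
Proof.
move: mk a b; apply: shuffle_ind => [|mk x a b _|mk a y b _] //= ->.
  by rewrite orbA.
by rewrite orbCA.
Qed.

(** A mask splits a word into its left and right letters; there are 'C(m1 + m2, m1) masks, each
    contributing [c]. The induction strips the first letter, and the two cases add up by Pascal's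
    rule. *)
Lemma wsum_interleave m1 m2 (F : seq (A + B) -> nat) c :
    (forall mk, size mk = m1 + m2 -> count id mk = m1 ->
      wsum m1 (fun a => wsum m2 (fun b => F (interleave mk a b))) = c) ->
  wsum (m1 + m2) (fun t => (count is_inl t == m1) * F t) = 'C(m1 + m2, m1) * c.
Proof.
move Em: (m1 + m2) => m; elim: m => [|m IHm] in m1 m2 F Em *.
  move/eqP: Em; rewrite addn_eq0 => /andP[/eqP -> /eqP ->] /(_ [::]).
  by rewrite !wsum0 => <-.
move=> Fc; rewrite wsumS big_sumType.
have Sl : \sum_x wsum m (fun t => ((count is_inl t).+1 == m1) * F (inl x :: t)) =
    (if m1 is m1'.+1 then 'C(m, m1') else 0) * c.
  case: m1 Em Fc => [|m1] Em Fc.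
    by rewrite big1 // => x _; apply: wsum_eq0 => t _.
  rewrite -wsum_sum; under eq_wsum => t _ do rewrite -big_distrr.
  apply: (IHm m1 m2); first by case: Em.
  move=> mk smk cmk; rewrite -(Fc (true :: mk)) /= ?smk ?cmk //.
  by rewrite wsumS -wsum_sum; apply: eq_wsum => a _; rewrite wsum_sum.
have Sr : \sum_y wsum m (fun t => (count is_inl t == m1) * F (inr y :: t)) =
    'C(m, m1) * c.
  case: m2 Em Fc => [|m2] Em Fc.
    (* Here m1 = m + 1: the binomial vanishes, and a word of length m is too short to have m1 left
       letters. *)
    rewrite bin_small ?mul0n; last by rewrite -Em addn0.
    rewrite big1 // => y _; apply: wsum_eq0 => t st.
    by rewrite ltn_eqF // -(addn0 m1) Em ltnS -st count_size.
  rewrite -wsum_sum; under eq_wsum => t _ do rewrite -big_distrr.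
  apply: (IHm m1 m2); first by move: Em; rewrite addnS => -[].
  move=> mk smk cmk; rewrite -(Fc (false :: mk)) /= ?smk ?cmk //.
  apply: eq_wsum => a _; rewrite wsumS -wsum_sum; apply: eq_wsum => b _.
  by apply: eq_bigr => y _; case: a.
rewrite [LHS](congr2 addn Sl Sr) -mulnDl; congr (_ * _).
by case: m1 {Em Fc Sl Sr} => [|m1]; rewrite ?bin0 // binS addnC.
Qed.

End Interleave.

Local Open Scope ring_scope.

(** * Primitivity of zeta *)

(** With arguments in [0, pi], the hypotheses say 0 < arg g <= arg h, so the quotient has argument
    in [0, arg h), and the cosine is strictly decreasing there. The proof works with real and
    imaginary parts only. *)
Lemma Re_divr_gt (g h : algC) : `|g| = 1 -> `|h| = 1 -> g != 1 ->
  0 <= 'Im g -> 0 <= 'Im h -> 'Re h <= 'Re g -> 'Re h < 'Re (h * g^-1).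
Proof.
move=> ng nh g1 sg sh le_hg.
have := normC2_Re_Im g; have := normC2_Re_Im h.
have -> : 'Re (h * g^-1) = 'Re h * 'Re g + 'Im h * 'Im g.
  rewrite -[g^-1]mul1r -(expr1n _ 2) -ng normCK mulrAC divff ?mul1r; last first.
    by rewrite -normr_eq0 ng oner_eq0.
  by rewrite ReM Re_conj Im_conj mulrN opprK.
have c_lt1 : 'Re g < 1.
  have le1 : 'Re g <= 1.
    by rewrite -ng; apply: le_trans (real_ler_norm (Creal_Re g)) (leif_normC_Re_Creal g).
  rewrite lt_neqAle le1 andbT; apply: contra g1 => /eqP c1.
  have /eqP : 'Im g ^+ 2 = 0.
    by apply: (addrI (1 ^+ 2)); rewrite -{1}c1 -normC2_Re_Im ng addr0.
  rewrite sqrf_eq0 => /eqP s0.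
  by rewrite [g]algCrect c1 s0 mulr0 addr0.
rewrite ng nh expr1n.
have := Creal_Re g; have := Creal_Re h; have := Creal_Im g; have := Creal_Im h.
move: sg sh le_hg c_lt1; set c := 'Re g; set s := 'Im g; set c' := 'Re h; set s' := 'Im h.
move=> s_ge0 s'_ge0 le_c c_lt1 Rs' Rs Rc' Rc eh eg.
rewrite -subr_gt0.
(* For c' <= 0 the difference is (-c')(1 - c) + s's. For c' > 0, the bound c' <= c gives s <= s',
   and s^2 = 1 - c^2 turns the difference into (s' - s)s + (1 - c)(1 + c - c'). *)
have [c'_le0|c'_gt0] := real_leP Rc' (rpred0 _).
  have -> : c' * c + s' * s - c' = (- c') * (1 - c) + s' * s by ring.
  have [/eqP c'0|c'_neq0] := boolP (c' == 0).
    rewrite c'0 oppr0 mul0r add0r mulr_gt0 // lt_def ?s_ge0 ?s'_ge0 andbT.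
      by apply: contraTneq isT => s0; move: eh; rewrite c'0 s0 expr0n addr0 => /eqP;
        rewrite oner_eq0.
    apply: contraTneq isT => s0; move: eg; rewrite s0 expr0n addr0 => /esym/eqP.
    rewrite sqrf_eq1 => /orP[] /eqP cE; first by move: c_lt1; rewrite cE ltxx.
    by move: le_c; rewrite c'0 cE ler0N1.
  apply: ltr_wpDr; first exact: mulr_ge0.
  by rewrite mulr_gt0 ?subr_gt0 // oppr_gt0 lt_neqAle c'_neq0.
have le_s : s <= s'.
  rewrite -(@ler_pXn2r _ 2) ?nnegrE //.
  have -> : s ^+ 2 = 1 - c ^+ 2 by rewrite eg; ring.
  have -> : s' ^+ 2 = 1 - c' ^+ 2 by rewrite eh; ring.
  by rewrite lerD2l lerN2 ler_pXn2r ?nnegrE ?(ltW c'_gt0) // (le_trans (ltW c'_gt0)).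
have -> : c' * c + s' * s - c' = (s' - s) * s + (1 - c) * (1 + c - c').
  have -> : (1 - c) * (1 + c - c') = (1 - c ^+ 2) - c' + c' * c by ring.
  by rewrite {1}eg; ring.
apply: ltr_wpDl; first by rewrite mulr_ge0 ?subr_ge0.
by rewrite mulr_gt0 ?subr_gt0 // (le_lt_trans le_c) // -subr_gt0 addrK.
Qed.

(* The nontrivial N-th root of unity g (N = 2r) with Im g >= 0 of largest real part
   generates all of them, hence satisfies g ^+ r = -1 and is r.-root (-1). *)
Lemma zeta_prim r : (0 < r)%N -> r.-primitive_root (zeta r).
Proof.
move=> r_gt0; set N := (2 * r)%N.
have N_gt0 : (0 < N)%N by rewrite muln_gt0.
have [e eP] := C_prim_root_exists N_gt0.
have nrm (z : algC) : z ^+ N = 1 -> `|z| = 1.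
  move=> zN; apply/eqP; rewrite -(@pexpr_eq1 _ _ N) // ?normr_ge0 //.
  by rewrite -normrX zN normr1.
have er : e ^+ r = -1.
  have : (e ^+ r) ^+ 2 == 1 by rewrite -exprM mulnC prim_expr_order.
  rewrite sqrf_eq1 => /orP[|/eqP//].
  rewrite -[1]/(e ^+ 0) (eq_prim_root_expr eP) mod0n modn_small ?(gtn_eqF r_gt0) //.
  by rewrite ltn_Pmull.
have [j gj gmax] : exists2 j : 'I_N, (e ^+ j != 1) && (0 <= 'Im (e ^+ j)) &
    forall z : algC, z ^+ N = 1 -> z != 1 -> 0 <= 'Im z -> 'Re z <= 'Re (e ^+ j).
  have lt_rN : (r < N)%N by rewrite ltn_Pmull.
  pose P (i : 'I_N) := (e ^+ i != 1) && (0 <= 'Im (e ^+ i)).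
  (* The power [e ^+ r] = -1 is a candidate, so the maximum is over a nonempty set. *)
  have Pr : P (Ordinal lt_rN).
    rewrite /P /= er eqr_oppLR -addr_eq0 (eqr_nat _ 2 0) /=.
    by rewrite (Creal_ImP _ _) ?rpredN1.
  case: (@real_arg_maxP _ _ (Ordinal lt_rN) P (fun i => 'Re (e ^+ i)) Pr).
    by move=> i _; apply: Creal_Re.
  move=> j Pj jmax; exists j => // z zN z1 Iz.
  have [i zE] := prim_rootP eP zN.
  by rewrite zE; apply: jmax; rewrite /P -zE z1.
move: gj gmax; set g := e ^+ j => /andP[g1 Ig] gmax.
have gN : g ^+ N = 1 by rewrite exprAC (prim_expr_order eP) expr1n.
have [d dP dN] := prim_order_exists N_gt0 gN.
have gd := prim_expr_order dP.
(* An N-th root of unity outside <g> in the upper half plane, chosen of maximal real part,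
   would be brought closer to 1 by a rotation by g^-1. *)
have all_g (z : algC) : z ^+ N = 1 -> z ^+ d = 1.
  (* Conjugation moves a counterexample into the upper half plane and keeps its real part. *)
  have upper (u : algC) : u ^+ N = 1 -> u ^+ d != 1 ->
      exists v : algC, [/\ v ^+ N = 1, v ^+ d != 1, 0 <= 'Im v & 'Re v = 'Re u].
    move=> uN ud; have [Iu|Iu] := real_leP (rpred0 _) (Creal_Im u); first by exists u.
    exists u^*; rewrite -!rmorphXn uN rmorph1 Im_conj Re_conj oppr_ge0 (ltW Iu).
    by split=> //; apply: contra ud => /eqP/(congr1 Num.conj); rewrite conjCK rmorph1 => ->.
  move=> zN; apply/eqP; apply: contraT => zd.
  have [v [vN vd Iv _]] := upper z zN zd.
  have [i0 v0E] := prim_rootP eP vN.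
  pose Q (i : 'I_N) := ((e ^+ i) ^+ d != 1) && (0 <= 'Im (e ^+ i)).
  have Q0 : Q i0 by rewrite /Q -v0E vd.
  case: (@real_arg_maxP _ _ i0 Q (fun i => 'Re (e ^+ i)) Q0).
    by move=> i _; apply: Creal_Re.
  move=> i; rewrite /Q; set h := e ^+ i => /andP[hd Ih] hmax.
  have hN : h ^+ N = 1 by rewrite exprAC (prim_expr_order eP) expr1n.
  have h1 : h != 1 by apply: contra hd => /eqP ->; rewrite expr1n.
  have hgN : (h * g^-1) ^+ N = 1 by rewrite exprMn exprVn hN gN invr1 mulr1.
  have hgd : (h * g^-1) ^+ d != 1 by rewrite exprMn exprVn gd invr1 mulr1.
  have [u [uN ud Iu Ru]] := upper _ hgN hgd.
  have [k uE] := prim_rootP eP uN.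
  have gt_h := Re_divr_gt (nrm _ gN) (nrm _ hN) g1 Ig Ih (gmax _ hN h1 Ih).
  by have := hmax k; rewrite -uE ud Iu Ru => /(_ isT)/(lt_le_trans gt_h); rewrite ltxx.
have {dP dN gd all_g} gP : N.-primitive_root g.
  suff <- : d = N by [].
  apply/eqP; rewrite eqn_dvd dN /= (prim_order_dvd eP).
  by rewrite all_g ?prim_expr_order.
have gr : g ^+ r = -1.
  have : (g ^+ r) ^+ 2 == 1 by rewrite -exprM mulnC prim_expr_order.
  rewrite sqrf_eq1 => /orP[|/eqP//].
  rewrite -[1]/(g ^+ 0) (eq_prim_root_expr gP) mod0n modn_small ?(gtn_eqF r_gt0) //.
  by rewrite ltn_Pmull.
have xr : (r.-root (-1) : algC) ^+ r = -1 by apply: rootCK.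
have le_gx := rootC_Re_max r_gt0 gr Ig.
rewrite /zeta; set x := r.-root _ in xr le_gx *.
have xN : x ^+ N = 1 by rewrite /N mulnC exprM xr sqrrN expr1n.
have Ix : 0 <= 'Im x.
  case: (ltngtP r 1) r_gt0 => [|r1 _|r1 _]; [by case: (r)| exact: Im_rootC_ge0|].
  by rewrite /x r1 root1C (Creal_ImP _ _) ?rpredN1.
have x1 : x != 1.
  apply: contraTneq isT => x1; move: xr; rewrite x1 expr1n => /eqP.
  by rewrite -addr_eq0 (eqr_nat _ 2 0).
(* [x] is itself a candidate for the maximum, while it has the largest real part among the r-th
   roots of -1 in the upper half plane, one of which is [g]. Modulus and sign of the imaginary part
   then determine the point. *)
have eqRe : 'Re x = 'Re g by apply: le_anti; rewrite gmax.
suff -> : x = g.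
  have := exp_prim_root gP 2; rewrite (gcdn_idPl _) ?dvdn_mulr //.
  by rewrite /N mulKn.
rewrite [x]algCrect [g]algCrect eqRe; congr (_ + _ * _).
apply/eqP; rewrite -(@eqrXn2 _ 2) //; apply/eqP.
by apply: (addrI ('Re x ^+ 2)); rewrite {2}eqRe -!normC2_Re_Im !nrm.
Qed.

(** * Exponent vectors of factorizations *)

Section Transport.

Variable n : nat.
Implicit Types (p : {perm 'I_n}) (e : seq ('I_n * 'I_n)).

(** Permutations compose from left to right, so the new transposition acts last, like a matrix
    multiplied on the left. *)
Definition edge_perm p (ij : 'I_n * 'I_n) : {perm 'I_n} := (p * tperm ij.1 ij.2)%g.

(** Exponents are indexed by columns: a factor on the edge (i, j), met when the partial product is
    p, alters the exponents at p^-1 i and p^-1 j. *)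
Fixpoint pullback p e : seq ('I_n * 'I_n) :=
  if e is ij :: e' then
    ((p^-1)%g ij.1, (p^-1)%g ij.2) :: pullback (edge_perm p ij) e'
  else [::].

Definition edge_graph e : rel 'I_n := fun x y =>
  has (fun ij => ((x == ij.1) && (y == ij.2)) || ((x == ij.2) && (y == ij.1))) e.

Definition edge_connected e := [forall x, forall y, connect (edge_graph e) x y].

(** Each partial product keeps every point in its [R]-class, so an edge is related as soon as its
    pullback is; the transposition along that edge then preserves the property. *)
Lemma pullback_rel (R : 'I_n -> 'I_n -> Prop) e p :
    (forall x, R x x) -> (forall x y, R x y -> R y x) ->
    (forall x y z, R x y -> R y z -> R x z) ->
    (forall x, R (p x) x) ->
    (forall uv, uv \in pullback p e -> R uv.1 uv.2) ->
  forall ij, ij \in e -> R ij.1 ij.2.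
Proof.
move=> Rxx Rsym Rtr; elim: e p => [|ij e IHe] p //= pR uvR.
have Rij : R ij.1 ij.2.
  have Ruv := uvR _ (mem_head _ _).
  have {Ruv}/= := Rtr _ _ _ (Rtr _ _ _ (pR _) Ruv) (Rsym _ _ (pR _)).
  by rewrite !permKV.
have pR' x : R (edge_perm p ij x) x.
  rewrite permM; apply: Rtr (pR x); case: tpermP => // ->; last exact: Rij.
  exact: Rsym.
move=> kl; rewrite inE => /orP[/eqP -> //|]; apply: IHe pR' _ _ => uv uv_e.
by apply: uvR; rewrite inE uv_e orbT.
Qed.

(** The preceding induction, started at the identity, puts the original edges into [R]; paths along
    them join any two vertices. *)
Lemma connected_rel (R : 'I_n -> 'I_n -> Prop) e :
    (forall x, R x x) -> (forall x y, R x y -> R y x) ->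
    (forall x y z, R x y -> R y z -> R x z) -> edge_connected e ->
    (forall uv, uv \in pullback 1%g e -> R uv.1 uv.2) ->
  forall x y, R x y.
Proof.
move=> Rxx Rsym Rtr conn_e uvR x y.
have {uvR} eR := pullback_rel Rxx Rsym Rtr (fun x => eq_ind_r (R^~ x) (Rxx x) (perm1 x)) uvR.
move/forallP/(_ x)/forallP/(_ y)/connectP: conn_e => [q path_q ->] {y}.
elim: q x path_q => [|y q IHq] x //= /andP[/hasP[ij ij_e xy] /IHq Ryq].
by apply: Rtr Ryq; case/orP: xy => /andP[/eqP -> /eqP ->]; [|apply: Rsym]; apply: eR.
Qed.

End Transport.

(** * Labellings with a prescribed exponent vector *)

Section Fibers.

Variables r' s n : nat.
Local Notation r := r'.+1.
Local Notation K := 'I_r.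
Local Notation I := 'I_n.
Local Notation lbl := (label r s n).
Local Notation vec := {ffun I -> K}.
Implicit Types (a d h : vec) (p : {perm I}) (st : {perm I} * vec) (mk : bitseq).
Implicit Types (e : seq (I * I)) (b : seq (I * 'I_(r %/ s))).

Definition spike (u : I) (k : K) : vec := [ffun x => if x == u then k else 0].

Lemma spikeD u k l : spike u (k + l) = spike u k + spike u l.
Proof. by apply/ffunP => x; rewrite !ffunE; case: eqP; rewrite ?addr0. Qed.

Lemma sum_spike u k : \sum_x spike u k x = k.
Proof.
rewrite (bigD1 u) //= big1 ?addr0 ?ffunE ?eqxx // => x /negPf xu.
by rewrite ffunE xu.
Qed.

Lemma sum_vecD a h : \sum_x (a + h) x = \sum_x a x + \sum_x h x.
Proof. by rewrite -big_split; apply: eq_bigr => x _; rewrite ffunE. Qed.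

Lemma sum_vecN a : \sum_x (- a) x = - \sum_x a x.
Proof. by rewrite -sumrN; apply: eq_bigr => x _; rewrite ffunE. Qed.

(* (p, a) stands for the monomial matrix sending e_x to zeta ^ (a x) * e_(p x). *)
Definition step st (l : lbl) : {perm I} * vec :=
  match l with
  | inl (i, j, k) => (edge_perm st.1 (i, j),
      st.2 + (spike ((st.1^-1)%g i) k - spike ((st.1^-1)%g j) k))
  | inr (i, k) => (st.1, st.2 + spike ((st.1^-1)%g i) (inZp (s * k)))
  end.

Definition run st (t : seq lbl) := foldl step st t.

Lemma run_shift h p a (t : seq lbl) :
  run (p, a + h) t = ((run (p, a) t).1, (run (p, a) t).2 + h).
Proof.
elim: t p a => [|[[[i j] k]|[i k]] t IHt] p a //=; first by rewrite /= addrAC IHt.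
by rewrite addrAC IHt.
Qed.

(** Contribution of a factor to the coordinate sum: a transposition adds its label at one end and
    subtracts it at the other. *)
Definition weight (l : lbl) : K := if l is inr (_, k) then inZp (s * k) else 0.

Lemma sum_run st (t : seq lbl) :
  \sum_x (run st t).2 x = \sum_x st.2 x + \sum_(l <- t) weight l.
Proof.
elim: t st => [|[[[i j] k]|[i k]] t IHt] st; rewrite ?big_nil ?addr0 //= IHt big_cons /=;
  rewrite !(sum_vecD, sum_vecN, sum_spike) ?subrr ?addr0 ?add0r //.
by rewrite addrA.
Qed.

Lemma weight_interleave mk (e : seq (I * I * K)) b : shuffle mk e b ->
  \sum_(l <- interleave mk e b) weight l = \sum_(y <- b) inZp (s * y.2).
Proof.
move: mk e b; apply: shuffle_ind => [|mk x a b _ IH|mk a [y k] b _ IH] /=.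
- by rewrite !big_nil.
- by rewrite big_cons IH add0r.
by rewrite !big_cons IH.
Qed.

Lemma run_perm mk e b ks st : shuffle mk e b -> size ks = size e ->
  (run st (interleave mk (zip e ks) b)).1 = foldl (@edge_perm n) st.1 e.
Proof.
move=> sh; move: mk e b sh ks st.
apply: shuffle_ind => [|mk [i j] e b _ IH|mk e [y k] b _ IH] //=.
  by case=> [|k ks] // st [sks]; rewrite /run /= IH.
by move=> ks st sks; rewrite /run /= IH.
Qed.

(** Edges, loops and their interleaving are fixed; only the labels of the transpositions vary. *)
Definition fiber mk e b p a d : nat :=
  wsum (size e) (fun ks => (run (p, a) (interleave mk (zip e ks) b)).2 == d : nat).

Lemma fiber_cons_edge mk ij e b p a d :
  fiber (true :: mk) (ij :: e) b p a d =
    (\sum_k fiber mk e b (edge_perm p ij)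
       (a + (spike ((p^-1)%g ij.1) k - spike ((p^-1)%g ij.2) k))%R d)%N.
Proof. by rewrite /fiber wsumS; case: ij. Qed.

Lemma fiber_cons_loop mk e y b p a d :
  fiber (false :: mk) e (y :: b) p a d =
    fiber mk e b p (a + spike ((p^-1)%g y.1) (inZp (s * y.2))) d.
Proof. by apply: eq_wsum => ks _; case: y => i k /=; case: (zip e ks). Qed.

(* Shifting along an edge reindexes the label of the factor that carries it. *)
Lemma fiber_pullback mk e b p a d uv k : shuffle mk e b -> uv \in pullback p e ->
  fiber mk e b p (a + (spike uv.1 k - spike uv.2 k)) d = fiber mk e b p a d.
Proof.
move=> sh; move: mk e b sh p a.
apply: shuffle_ind => [|mk ij e b _ IH|mk e y b _ IH] p a //=; last first.
  by move=> uv_e; rewrite !fiber_cons_loop addrAC IH.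
rewrite inE !fiber_cons_edge => /orP[/eqP -> /=|uv_e]; last first.
  by apply: eq_bigr => l _; rewrite addrAC IH.
rewrite [RHS](reindex_inj (addrI k)); apply: eq_bigr => l _; congr fiber.
by rewrite !spikeD -addrA opprD [in RHS]addrACA.
Qed.

(** The shifts that leave the count unchanged for every start form a group. It contains the
    multiples of e_u - e_v for pulled-back edges, hence by connectedness for all pairs, and these
    generate the vectors of sum zero. *)
Lemma fiber_shift mk e b a d h : shuffle mk e b -> edge_connected e ->
  \sum_x h x = 0 -> fiber mk e b 1%g (a + h) d = fiber mk e b 1%g a d.
Proof.
move=> sh conn_e h0.
pose per h := forall a, fiber mk e b 1%g (a + h) d = fiber mk e b 1%g a d.
have per0 : per 0 by move=> a'; rewrite addr0.
have perD h1 h2 : per h1 -> per h2 -> per (h1 + h2).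
  by move=> per1 per2 a'; rewrite addrA per2 per1.
have perN h1 : per h1 -> per (- h1).
  by move=> per1 a'; rewrite -{2}[a'](subrK h1) per1.
have per_edge : forall x y k, per (spike x k - spike y k).
  apply: (@connected_rel n (fun x y => forall k, per (spike x k - spike y k)) e) => //.
  - by move=> x k; rewrite subrr.
  - by move=> x y xy k; rewrite -opprB; apply: perN.
  - by move=> x y z xy yz k; rewrite -[spike x k](subrK (spike y k)) -addrA; apply: perD.
  by move=> uv uv_e k a'; apply: fiber_pullback.
suff : per h by apply.
have [x0 _|I0] := pickP (@predT I); last first.
  suff -> : h = 0 by [].
  by apply/ffunP => x; have := I0 x.
(* Any base point serves: the coefficients of [spike x0] add up to minus the sum of [h], which is
   zero. *)
have -> : h = \sum_x (spike x (h x) - spike x0 (h x)).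
  apply/ffunP => y; rewrite sum_ffunE.
  have -> : \sum_x (spike x (h x) - spike x0 (h x)) y =
      \sum_x spike x (h x) y - \sum_x spike x0 (h x) y.
    by rewrite -sumrB; apply: eq_bigr => x _; rewrite !ffunE.
  rewrite (bigD1 y) //= big1 => [|x /negPf xy]; last by rewrite ffunE eq_sym xy.
  rewrite addr0 ffunE eqxx; have -> : \sum_x spike x0 (h x) y = 0; last by rewrite subr0.
  under eq_bigr => x _ do rewrite ffunE.
  by case: eqP => _; [exact: h0|exact: big1].
by apply: (big_ind per) => // x _; apply: per_edge.
Qed.

Lemma fiber_target mk e b a d h :
  fiber mk e b 1%g a (d + h) = fiber mk e b 1%g (a - h) d.
Proof. by apply: eq_wsum => ks _; rewrite run_shift subr_eq. Qed.

(** Adding a multiple of a basis vector maps the vectors of sum 0 onto those of any other sum, so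
    the r classes are equally large. *)
Lemma card_sum_eq S : (0 < n)%N -> #|[set d : vec | \sum_x d x == S]| = (r ^ n.-1)%N.
Proof.
move=> n_gt0; pose x0 := Ordinal n_gt0.
pose N S := #|[set d : vec | \sum_x d x == S]|.
have NE T : N T = N 0.
  rewrite /N -[RHS](card_imset _ (addrI (spike x0 T))); apply: eq_card => d.
  apply/idP/imsetP => [|[h]]; rewrite !inE => /eqP.
    move=> dT; exists (d - spike x0 T); last by rewrite addrC subrK.
    by rewrite inE sum_vecD sum_vecN sum_spike dT subrr.
  by move=> h0 ->; rewrite sum_vecD sum_spike h0 addr0.
have : (\sum_(T : K) N T = r ^ n)%N.
  transitivity #|vec|; last by rewrite card_ffun !card_ord.
  rewrite -sum1_card (partition_big (fun d : vec => \sum_x d x) predT) //=.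
  by apply: eq_bigr => T _; rewrite /N -sum1dep_card.
under eq_bigr => T _ do rewrite NE -(NE S).
rewrite sum_nat_const card_ord -{1}(prednK n_gt0) expnS => /eqP.
by rewrite eqn_pmul2l // => /eqP.
Qed.

(** All labellings end on vectors of sum [S], and by [fiber_shift] they spread evenly over the
    r^(n-1) of these; the product form avoids a division. *)
Lemma fiber_card mk e b d : (0 < n)%N -> shuffle mk e b -> edge_connected e ->
  (r ^ n.-1 * fiber mk e b 1%g 0%R d =
    (\sum_x d x == \sum_(y <- b) inZp (s * y.2))%R * r ^ size e)%N.
Proof.
move=> n_gt0 sh conn_e; set S := \sum_(y <- b) _.
have sum_final ks : size ks = size e ->
    \sum_x (run (1%g, 0) (interleave mk (zip e ks) b)).2 x = S.
  move=> sks; rewrite sum_run weight_interleave; last first.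
    by move: sh; rewrite /shuffle size_zip sks minnn.
  by rewrite big1 ?add0r // => x _; rewrite ffunE.
case: eqP => [dS|dS]; last first.
  rewrite /fiber wsum_eq0 ?muln0 // => ks sks.
  by case: eqP => // df; case: dS; rewrite -df sum_final.
rewrite mul1n -(card_sum_eq S n_gt0) -sum_nat_const.
(* Summing over all targets counts each labelling once. *)
transitivity (\sum_(d' : vec) fiber mk e b 1%g 0%R d')%N; last first.
  rewrite /fiber -wsum_sum.
  transitivity (@wsum K (size e) (fun=> 1%N)); last by rewrite wsum_const card_ord muln1.
  apply: eq_wsum => ks _; rewrite (bigD1 (run (1%g, 0) (interleave mk (zip e ks) b)).2) //=.
  by rewrite eqxx big1 // => d' /negPf; rewrite eq_sym => ->.
rewrite [RHS](bigID (mem [set d' : vec | \sum_x d' x == S])) /= [X in (_ + X)%N]big1.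
  rewrite addn0; apply: eq_bigr => d'; rewrite inE => /eqP d'S.
  rewrite -[d'](subrK d) addrC fiber_target fiber_shift // sum_vecN sum_vecD sum_vecN.
  by rewrite d'S dS subrr oppr0.
move=> d'; rewrite inE => d'S; apply: wsum_eq0 => ks sks.
by case: eqP => // df; case/eqP: d'S; rewrite -df sum_final.
Qed.

End Fibers.

(** * Monomial matrices *)

Section Monomial.

Variables r' s n : nat.
Local Notation r := r'.+1.
Local Notation K := 'I_r.
Local Notation I := 'I_n.
Local Notation lbl := (label r s n).
Local Notation vec := {ffun I -> K}.
Implicit Types (a : vec) (p : {perm I}) (st : {perm I} * vec) (k l : K).

Let zetaP : r.-primitive_root (zeta r) := zeta_prim (ltn0Sn r').

Definition zexp k : algC := zeta r ^+ k.

Lemma zexpD k l : zexp (k + l) = zexp k * zexp l.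
Proof. by rewrite /zexp -exprD -[RHS](prim_expr_mod zetaP). Qed.

Lemma zexp0 : zexp 0 = 1. Proof. by []. Qed.

Lemma zexp_inj : injective zexp.
Proof.
move=> k l /eqP; rewrite (eq_prim_root_expr zetaP) !modn_small // => /eqP.
exact: val_inj.
Qed.

Lemma zexp_inZp m : zexp (inZp m) = zeta r ^+ m.
Proof. by rewrite /zexp /= (prim_expr_mod zetaP). Qed.

Lemma zexp_neq0 k : zexp k != 0.
Proof.
have : zexp k ^+ r != 0.
  by rewrite exprAC (prim_expr_order zetaP) expr1n oner_eq0.
by rewrite expf_eq0.
Qed.

Lemma zexpN k : zexp (- k) = (zexp k)^-1.
Proof.
by apply: (mulfI (zexp_neq0 k)); rewrite -zexpD subrr zexp0 divff // zexp_neq0.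
Qed.

Lemma zexp_sum (J : Type) (q : seq J) (P : pred J) (F : J -> K) :
  zexp (\sum_(i <- q | P i) F i) = \prod_(i <- q | P i) zexp (F i).
Proof. by apply: (big_morph zexp zexpD zexp0). Qed.

Definition mono_mx st : 'M[algC]_n :=
  \matrix_(y, x) (if y == st.1 x then zexp (st.2 x) else 0).

Lemma mono_mx_neq0 st y x : (mono_mx st y x != 0) = (y == st.1 x).
Proof. by rewrite mxE; case: (y =P _) => _; rewrite ?eqxx ?zexp_neq0. Qed.

Lemma mono_mx_inj : injective mono_mx.
Proof.
move=> [p a] [q b] eq_mx.
have eqpq : p = q.
  apply/permP => x; apply/eqP.
  by rewrite -[_ == _](mono_mx_neq0 (q, b) (p x) x) -eq_mx mono_mx_neq0 /= eqxx.
rewrite eqpq in eq_mx *; congr pair; apply/ffunP => x; apply: zexp_inj.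
by move/matrixP/(_ (q x) x): eq_mx; rewrite !mxE /= eqxx.
Qed.

Lemma mono_mx1 : mono_mx (1%g, 0) = 1%:M.
Proof. by apply/matrixP => y x; rewrite !mxE /= perm1 ffunE zexp0; case: eqP. Qed.

(** A column with p x = i moves to row j and gains zeta^k; one with p x = j moves to row i and gains
    zeta^-k. This fixes the signs in [step]; validity ensures that i and j differ. *)
Lemma refl_mx_step st (l : lbl) :
  valid_label l -> refl_mx l *m mono_mx st = mono_mx (step st l).
Proof.
move=> vl; apply/matrixP => y x; rewrite mxE (bigD1 (st.1 x)) //= big1 ?addr0; last first.
  by move=> z /negPf zx; rewrite [mono_mx _ _ _]mxE zx mulr0.
rewrite [mono_mx _ _ _]mxE eqxx [mono_mx _ _ _]mxE.
have eqV i : (x == (st.1^-1)%g i) = (st.1 x == i).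
  by apply/eqP/eqP => [->|<-]; rewrite ?permKV ?permK.
case: l vl => [[[i j] k]|[i k]] /= vl; rewrite mxE /= !ffunE !eqV.
  have neq_ij : i == j = false by apply/negbTE; rewrite neq_ltn vl.
  rewrite permM /=; case: tpermP => [->|->|/eqP/negPf ni /eqP/negPf nj].
  - rewrite eqxx neq_ij subr0 zexpD mulrC.
    case: (y =P i) => [->|_]; first by rewrite neq_ij mulr0.
    by case: (y =P j) => // _; rewrite mulr0.
  - rewrite [j == i]eq_sym neq_ij eqxx sub0r zexpD zexpN mulrC.
    case: (y =P i) => // _; case: (y =P j) => _; by rewrite mulr0.
  rewrite ni nj subr0 addr0.
  case: (y =P i) => [->|_]; first by rewrite eq_sym ni mul0r.
  case: (y =P j) => [->|_]; first by rewrite eq_sym nj mul0r.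
  by case: eqP; rewrite ?mul1r ?mul0r.
case: (y =P st.1 x) => [->|]; last by rewrite mul0r.
by case: (st.1 x =P i) => _; rewrite ?addr0 ?mul1r // zexpD zexp_inZp mulrC.
Qed.

Lemma prod_refl_run (t : seq lbl) : all (@valid_label r s n) t ->
  prod_refl t = mono_mx (run (1%g, 0) t).
Proof.
rewrite /prod_refl /run -mono_mx1; elim: t (1%g, 0) => //= l t IHt st /andP[vl vt].
by rewrite refl_mx_step // IHt.
Qed.

Lemma phi_mono_mx st : phi (mono_mx st) = zexp (\sum_x st.2 x).
Proof.
rewrite /phi zexp_sum.
rewrite (eq_bigl (fun ij => ij.1 == st.1 ij.2)) => [|ij]; last exact: mono_mx_neq0.
rewrite (reindex_onto (fun x => (st.1 x, x)) snd) => [|[y x] /= /eqP -> //].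
by apply: eq_big => [x|x _]; rewrite ?mxE /= !eqxx.
Qed.

(** The column condition gives a map, the row condition its injectivity, and primitivity of zeta the
    exponents. *)
Lemma inG_mono_mx (w : 'M[algC]_n) : inG r s w -> exists st, w = mono_mx st.
Proof.
case/and4P=> /forallP rowP /forallP colP /forallP rootP _.
have colE x : exists y, forall z, (w z x != 0) = (z == y).
  have /card1P[y yP] := colP x; exists y => z.
  by move: (yP z); rewrite !inE.
(* The default [x] is never taken, as each column has a nonzero entry. *)
pose f x := odflt x [pick y | w y x != 0].
have fE x y : (w y x != 0) = (y == f x).
  have [z zP] := colE x; rewrite zP /f; case: pickP => [y'|/(_ z)].
    by rewrite zP => /eqP ->.
  by rewrite zP eqxx.
have f_inj : injective f.
  move=> x x' fxx'; have /card1P[z zP] := rowP (f x).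
  have := zP x; have := zP x'; rewrite !inE !fE {1}fxx' !eqxx.
  by move=> /esym/eqP -> /esym/eqP ->.
have expE x : exists k : K, w (f x) x = zexp k.
  have := rootP (f x) => /forallP/(_ x); rewrite fE eqxx => /eqP wr.
  by have [k ->] := prim_rootP zetaP wr; exists k.
have [a aP] := fin_all_exists expE.
exists (perm f_inj, [ffun x => a x]); apply/matrixP => y x; rewrite mxE /= permE ffunE.
case: eqP => [->|/eqP]; first exact: aP.
by rewrite -fE negbK => /eqP.
Qed.

(** * Counting factorizations of a monomial matrix *)

Lemma mu_fact_num_wsum m kappa :
  mu_fact_num r s m kappa = wsum m (fun u : seq 'I_(r %/ s) =>
    all (fun k : 'I_(r %/ s) => k != 0%N :> nat) u &&
      (\prod_(k <- u) zeta r ^+ (s * k) == kappa) : nat).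
Proof.
by rewrite /mu_fact_num -sum1dep_card big_mkcond; apply: eq_bigr => u _; case: ifP.
Qed.

Lemma mu_fact_numE m (T : K) :
  mu_fact_num r s m (zexp T) = wsum m (fun u : seq 'I_(r %/ s) =>
    all (fun k : 'I_(r %/ s) => k != 0%N :> nat) u &&
      (T == \sum_(k <- u) inZp (s * k)) : nat).
Proof.
rewrite mu_fact_num_wsum; apply: eq_wsum => u _; congr (_ && _ : nat).
under eq_bigr => k _ do rewrite -zexp_inZp.
by rewrite -zexp_sum (inj_eq zexp_inj) eq_sym.
Qed.

(** Loops join no two distinct vertices and [connect] is reflexive, so only the transpositions
    matter. *)
Lemma fact_graph_interleave mk (e : seq (I * I * K)) b : shuffle mk e b ->
  connected_fact (interleave mk e b : seq lbl) = edge_connected (map fst e).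
Proof.
move=> sh; apply: eq_forallb => x; apply: eq_forallb => y.
have graphE u v : u != v -> fact_graph (interleave mk e b : seq lbl) u v =
    edge_graph (map fst e) u v.
  move=> uv; rewrite /fact_graph has_interleave // [X in _ || X]negbTE ?orbF.
    by rewrite /edge_graph has_map; apply: eq_has => -[[i j] k].
  rewrite -all_predC; apply/allP => -[i k] _ /=.
  by apply: contra uv => /andP[/eqP -> /eqP ->].
by apply/idP/idP; apply: connect_sub => u v uv; have [->|neq_uv] := eqVneq u v;
  rewrite ?connect0 // connect1 ?graphE // -graphE.
Qed.

(** The connected factorization number of [p] in S_n, as [conn_fact_num_perm] confirms. *)
Definition edge_fact_num p m : nat :=
  wsum m (fun e : seq (I * I) => [&& all (fun ij : I * I => (ij.1 < ij.2)%N) e,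
    foldl (@edge_perm n) 1%g e == p & edge_connected e] : nat).

(** Separates the conditions on edges, on loops and on exponents; only the last involves the labels
    [ks], and it is what [fiber] counts. *)
Lemma fact_interleave p a mk (e : seq (I * I)) ks b :
    shuffle mk e b -> size ks = size e ->
  let t : seq lbl := interleave mk (zip e ks) b in
  (is_fact (mono_mx (p, a)) t && connected_fact t : nat) =
  (([&& all (fun ij : I * I => (ij.1 < ij.2)%N) e, foldl (@edge_perm n) 1%g e == p
      & edge_connected e] *
    all (fun y : I * 'I_(r %/ s) => y.2 != 0%N :> nat) b) * ((run (1%g, 0%R) t).2 == a))%N.
Proof.
move=> sh sks t; have sh' : shuffle mk (zip e ks) b.
  by move: sh; rewrite /shuffle size_zip sks minnn.
have -> : is_fact (mono_mx (p, a)) t =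
    all (@valid_label r s n) t && (((run (1%g, 0) t).1 == p) && ((run (1%g, 0) t).2 == a)).
  apply: andb_id2l => vt.
  by rewrite prod_refl_run // (inj_eq mono_mx_inj); case: (run _ _).
rewrite fact_graph_interleave // all_interleave // run_perm // -!/(unzip1 _).
rewrite unzip1_zip ?sks //.
have -> : all (@valid_label r s n \o inl) (zip e ks) = all (fun ij : I * I => (ij.1 < ij.2)%N) e.
  rewrite -[in RHS](unzip1_zip (eq_leq (esym sks))) all_map.
  by apply: eq_all => -[[i j] k].
have -> : all (@valid_label r s n \o inr) b = all (fun y : I * 'I_(r %/ s) => y.2 != 0%N :> nat) b.
  by apply: eq_all => -[i k] /=; rewrite lt0n.
rewrite -/t !mulnb; congr nat_of_bool.
by case: (all _ e); case: (all _ b); case: (foldl _ _ _ == p); case: edge_connected;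
  rewrite ?andbT ?andbF.
Qed.

(** The power r^(n-1) on the left clears the denominator of the fiber count. *)
Lemma conn_fact_num2_mono m1 m2 p a : (0 < n)%N ->
  (r ^ n.-1 * conn_fact_num2 r s m1 m2 (mono_mx (p, a)) =
   'C(m1 + m2, m1) * (edge_fact_num p m1 *
     (n ^ m2 * mu_fact_num r s m2 (phi (mono_mx (p, a))) * r ^ m1)))%N.
Proof.
move=> n_gt0; rewrite phi_mono_mx mu_fact_numE /=.
have -> : conn_fact_num2 r s m1 m2 (mono_mx (p, a)) =
    wsum (m1 + m2) (fun t : seq lbl => (count (@is_inl _ _) t == m1) *
      (is_fact (mono_mx (p, a)) t && connected_fact t))%N.
  rewrite /conn_fact_num2 -sum1dep_card big_mkcond; apply: eq_bigr => t _ /=.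
  by rewrite mulnb andbA andbC; case: (_ && _).
rewrite -wsumMl; under eq_wsum => t _ do rewrite mulnCA.
(* It remains to see that every mask gives the same count. *)
apply: wsum_interleave => mk smk cmk.
rewrite wsum_zip mulnC /edge_fact_num -[RHS]wsumMl; apply: eq_wsum => e se.
pose E := [&& all (fun ij : I * I => (ij.1 < ij.2)%N) e,
  foldl (@edge_perm n) 1%g e == p & edge_connected e].
transitivity (wsum m2 (fun b : seq (I * 'I_(r %/ s)) =>
    (E * all (fun y : I * 'I_(r %/ s) => y.2 != 0%N :> nat) b) *
      (r ^ n.-1 * fiber mk e b 1%g 0%R a)))%N.
  rewrite wsum_exchange; apply: eq_wsum => b sb; rewrite /fiber se -!wsumMl.
  apply: eq_wsum => ks sks; rewrite fact_interleave ?sks ?se // 1?mulnCA //.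
  by rewrite /shuffle se sb smk cmk !eqxx.
transitivity (wsum m2 (fun b : seq (I * 'I_(r %/ s)) =>
    E * r ^ m1 * (all (fun y : I * 'I_(r %/ s) => y.2 != 0%N :> nat) b &&
      (\sum_x a x == \sum_(y <- b) inZp (s * y.2))%R)))%N.
  apply: eq_wsum => b sb; have sh : shuffle mk e b.
    by rewrite /shuffle se sb smk cmk !eqxx.
  case EE: E; last by rewrite !mul0n.
  rewrite fiber_card // ?se; last by case/and3P: EE.
  by rewrite -mulnb !mul1n [RHS]mulnC mulnA.
rewrite wsumMl mulnC [(E * _)%N]mulnC mulnA; congr (_ * _ * _)%N.
(* A loop word splits into positions, which are free and give n^m2, and exponents, which factor
   phi. *)
rewrite wsum_zip -[X in (X ^ _)%N](card_ord n) -wsum_const; apply: eq_wsum => u su.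
apply: eq_wsum => v sv; have le_vu : (size v <= size u)%N by rewrite su sv.
by rewrite -[v in RHS](unzip2_zip le_vu) all_map big_map.
Qed.

(** * Closed form for factorizations in the cyclic group *)

Hypothesis (s_gt0 : (0 < s)%N) (s_dvd_r : (s %| r)%N).
Local Notation D := (r %/ s)%N.

Lemma mu_fact_num_rec m kappa : kappa ^+ D = 1 ->
  (mu_fact_num r s m.+1 kappa + mu_fact_num r s m kappa = D.-1 ^ m)%N.
Proof.
move=> kD; have D_gt0 : (0 < D)%N by rewrite divn_gt0 // dvdn_leq.
have zsP : D.-primitive_root (zeta r ^+ s).
  by have := exp_prim_root zetaP s; rewrite (gcdn_idPl s_dvd_r).
pose nz (k : 'I_D) := k != 0%N :> nat.
have -> : (D.-1 ^ m)%N = wsum m (fun u : seq 'I_D => all nz u : nat).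
  elim: m => [|m IHm]; first by rewrite wsum0.
  rewrite wsumS expnS IHm (bigD1 (Ordinal D_gt0)) //= [X in (X + _)%N]wsum_eq0 // add0n.
  have -> : D.-1 = #|predC1 (Ordinal D_gt0)| by rewrite cardC1 card_ord.
  rewrite -sum_nat_const.
  apply: eq_big => [k|k k0]; first by rewrite inE.
  by apply: eq_wsum => u _ /=; rewrite [nz k]k0.
rewrite !mu_fact_num_wsum wsumS (bigD1 (Ordinal D_gt0)) //= wsum_eq0 // add0n addnC.
(* Letting the first exponent also be 0 adds exactly the factorizations of length m. *)
transitivity (\sum_(k : 'I_D) wsum m (fun u => all nz u &&
    (zeta r ^+ (s * k) * \prod_(k <- u) zeta r ^+ (s * k) == kappa)%R : nat))%N.
  rewrite [RHS](bigD1 (Ordinal D_gt0)) //=; congr (_ + _)%N.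
    by apply: eq_wsum => u _; rewrite muln0 expr0 mul1r.
  by apply: eq_bigr => k k0; apply: eq_wsum => u _; rewrite big_cons [_ != _]k0.
rewrite -wsum_sum; apply: eq_wsum => u _.
case: (all nz u) => /=; last by rewrite big1.
set P := \prod_(k <- u) _.
have PD : P ^+ D = 1.
  rewrite -prodrXl big1 // => k _.
  by rewrite exprM -[LHS]exprM mulnC exprM (prim_expr_order zsP) expr1n.
have P0 : P != 0.
  by apply: contra_eq_neq PD => ->; rewrite expr0n gtn_eqF // eq_sym oner_eq0.
(* The other m factors force the first to be kappa / P, a D-th root of unity and so a unique power
   of zeta^s. *)
have [k0 k0E] : {k0 : 'I_D | kappa / P = (zeta r ^+ s) ^+ k0}.
  by apply: (prim_rootP zsP); rewrite exprMn exprVn PD kD invr1 mulr1.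
rewrite (bigD1 k0) //= exprM -k0E divfK // eqxx big1 // => k kk0.
rewrite exprM -[X in _ == X](divfK P0) (inj_eq (mulIf P0)) k0E
  (eq_prim_root_expr zsP) !modn_small //.
by move: kk0; rewrite -val_eqE /= => /negPf ->.
Qed.

Lemma mu_fact_num_closed m kappa : kappa ^+ D = 1 ->
  ((mu_fact_num r s m kappa)%:R : rat) =
    ((D%:R - 1) ^+ m - (-1) ^+ m) / D%:R + (kappa == 1)%:R * (-1) ^+ m.
Proof.
move=> kD; have D_gt0 : (0 < D)%N by rewrite divn_gt0 // dvdn_leq.
have D0 : (D%:R : rat) != 0 by rewrite pnatr_eq0 -lt0n.
elim: m => [|m IHm].
  by rewrite !expr0 subrr mul0r add0r mulr1 mu_fact_num_wsum wsum0 big_nil eq_sym.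
have /(congr1 (fun q => q%:R : rat)) := mu_fact_num_rec m kD.
rewrite natrD IHm natrX -subn1 natrB // => /(canRL (addrK _)) ->.
by rewrite !exprS; field.
Qed.

End Monomial.

(** * Specialization to the symmetric group, and the theorem *)

Lemma conn_fact_num_perm n m (p : {perm 'I_n}) (hn : (0 < n)%N) :
  conn_fact_num 1 1 m (@mono_mx 0 n (p, 0)) = edge_fact_num p m.
Proof.
(* With r = s = 1 and m2 = 0 all powers and the binomial are 1. *)
have := @conn_fact_num2_mono 0 1 n m 0 p 0 hn.
rewrite !exp1n phi_mono_mx mu_fact_numE wsum0 /= addn0 binn big_nil !mul1n.
rewrite [\sum_x _]ord1 eqxx !muln1 => <-.
transitivity (wsum (m + 0) (fun t : seq (label 1 1 n) =>
    is_fact (@mono_mx 0 n (p, 0)) t && connected_fact t : nat)).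
  by rewrite addn0 /conn_fact_num -sum1dep_card big_mkcond; apply: eq_bigr => t _; case: ifP.
rewrite /conn_fact_num2 -sum1dep_card big_mkcond; apply: eq_bigr => t _ /=.
rewrite andbA; case: andP => //= -[/andP[vt _] _].
(* A valid loop label would need 0 < k < 1, so all factors lie in R1. *)
suff -> : count (@inR1 1 1 n) t == m by [].
rewrite -[X in _ == X](addn0 m) -[X in _ == X](size_tuple t) -all_count.
by apply: sub_all vt => -[] // [i [[|k] ltk]].
Qed.

Theorem mainTheorem1 (r s n : nat) (hr : (0 < r)%N) (hs : (0 < s)%N) (hn : (0 < n)%N)
  (hsr : (s %| r)%N) (w : 'M[algC]_n) (hw : @inG r s n w) (m1 m2 : nat) :
  ((@conn_fact_num2 r s n m1 m2 w)%:R : rat) =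
    ((r%:R : rat) ^ (m1%:Z - n%:Z + 1) * (n%:R : rat) ^+ m2 * ('C(m1 + m2, m1))%:R
       * (@mu_fact_num r s m2 (@phi n w))%:R)
    * (@conn_fact_num 1 1 n m1 (@pi_mx n w))%:R
  /\ ((@mu_fact_num r s m2 (@phi n w))%:R : rat) =
    (((r %/ s)%:R - 1) ^+ m2 - (-1) ^+ m2) / (r %/ s)%:R
      + (@delta n w)%:R * (-1) ^+ m2.
Proof.
case: r hr hsr hw => // r' _ hsr hw; split; last first.
  by apply: mu_fact_num_closed => //; case/and4P: hw => _ _ _ /eqP.
have [[p a] wE] := inG_mono_mx hw.
have -> : pi_mx w = @mono_mx 0 n (p, 0).
  apply/matrixP => y x; rewrite mxE wE mono_mx_neq0 !mxE /= ffunE zexp0.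
  by case: eqP.
rewrite conn_fact_num_perm //.
have /(congr1 (fun q => q%:R : rat)) := conn_fact_num2_mono s m1 m2 p a hn.
rewrite -wE !natrM !natrX; case: n hn => // n' _ in w p a hw wE *.
have r0 : (r'.+1%:R : rat) != 0 by rewrite pnatr_eq0.
(* Cancelling r^(n-1) leaves r^(m1 - n + 1), whose exponent may be negative, hence the integer
   power. *)
move=> /= eq_num; apply: (mulfI (expf_neq0 n' r0)); rewrite eq_num.
have -> : m1%:Z - n'.+1%:Z + 1 = m1%:Z - n'%:Z by rewrite intS; ring.
rewrite expfzDr // -exprnN -exprnP; field.
exact: expf_neq0.
Qed.
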